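(* For every constant $c>0$ there exist constants $C,a>0$ such that the following holds. Let $G=(V,E)$ be a $d$-regular undirected graph on $n=|V|$ vertices, $2\le d<n$, which is a $\lambda$ spectral expander with $\lambda>0$ and $n\ge c\,d^3\log(d)^4/\lambda$. Then the graph code $(\mathrm{enc}_G,\mathrm{dec}_G)$ is an $\varepsilon$-non-malleable code in the split-state model with $\varepsilon\le C\,\log(d)^a\,\frac{\lambda^{3/2}}{d}$. (In the paper's notation: if $n=\Omega(d^3\log(d)^4/\lambda)$ then the code is $\tilde O(\lambda^{3/2}/d)$-non-malleable.)
   Context: $E\subseteq V\times V$ is the symmetric set of ordered pairs of adjacent vertices. $G$ is a $\lambda$ spectral expander if, with $\lambda_1\ge\dots\ge\lambda_n$ the eigenvalues of its adjacency matrix, $\lambda\ge\max\{|\lambda_2|,\dots,|\lambda_n|\}$. The graph code: $\mathrm{enc}_G\colon\{0,1\}\to V\times V$ is randomized, with $\mathrm{enc}_G(0)$ uniform on $(V\times V)\setminus E$ and $\mathrm{enc}_G(1)$ uniform on $E$; $\mathrm{dec}_G(v_1,v_2)=1$ if $(v_1,v_2)\in E$ and $0$ otherwise. Split-state non-malleability: a coding scheme $\mathrm{enc}\colon\mathcal M\to\mathcal L\times\mathcal R$, $\mathrm{dec}\colon\mathcal L\times\mathcal R\to\mathcal M\cup\{\bot\}$ (here $\mathcal M=\{0,1\}$, $\mathcal L=\mathcal R=V$) with $\Pr[\mathrm{dec}(\mathrm{enc}(s))=s]=1$ is $\varepsilon$-non-malleable in the split-state model if for every pair of functions $g\colon\mathcal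 L\to\mathcal L$, $h\colon\mathcal R\to\mathcal R$ there is a distribution $D_{g,h}$ on $\mathcal M\cup\{*,\bot\}$ such that for every $s\in\mathcal M$ the random variable $\mathrm{dec}(g(L),h(R))$ with $(L,R)\leftarrow\mathrm{enc}(s)$ and the random variable obtained by sampling $\tilde s\leftarrow D_{g,h}$ and outputting $s$ if $\tilde s=*$ and $\tilde s$ otherwise, have statistical distance at most $\varepsilon$. *)

(* Defs.v *)
From HB Require Import structures.
From mathcomp Require Import all_boot all_order all_algebra.
From mathcomp Require Import reals exp.
Set Implicit Arguments. Unset Strict Implicit. Unset Printing Implicit Defensive.
Import Order.TTheory GRing.Theory Num.Theory.
Local Open Scope ring_scope.

Definition undirected_simple (n : nat) (e : rel 'I_n) : Prop :=
  symmetric e /\ irreflexive e.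

Definition regular (n : nat) (e : rel 'I_n) (d : nat) : Prop :=
  forall v : 'I_n, #|[set u | e v u]| = d.

Definition adj_mx (R : pzRingType) (n : nat) (e : rel 'I_n) : 'M[R]_n :=
  \matrix_(i, j) (e i j)%:R.

(* G is a lambda spectral expander: with lambda_1 >= ... >= lambda_n the
   eigenvalues of the adjacency matrix (listed with multiplicity, i.e. the
   roots of its characteristic polynomial), lambda >= |lambda_i| for i >= 2. *)
Definition spectral_expander (R : realType) (n : nat) (e : rel 'I_n) (lam : R)
  : Prop :=
  exists s : seq R,
    [/\ size s = n,
        sorted (fun x y => y <= x) s,
        char_poly (adj_mx R e) = \prod_(x <- s) ('X - x%:P)
      & forall i : nat, (0 < i < n)%N -> `|s`_i| <= lam].

(* Graph code decoder: dec(v1,v2) = 1 iff (v1,v2) in E.  Outputs live in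
   M u {bot} = option bool (None = bot); dec never outputs bot. *)
Definition graph_dec (n : nat) (e : rel 'I_n) (u v : 'I_n) : option bool :=
  Some (e u v).

(* Distribution of dec(g L, h R) with (L,R) <- enc_G(s):
   enc_G(1) uniform on E, enc_G(0) uniform on (V x V) \ E. *)
Definition tamper_dist (R : realType) (n : nat) (e : rel 'I_n)
  (g h : 'I_n -> 'I_n) (s : bool) (o : option bool) : R :=
  #|[set p : 'I_n * 'I_n | (e p.1 p.2 == s) &&
                           (graph_dec e (g p.1) (h p.2) == o)]|%:R
  / #|[set p : 'I_n * 'I_n | e p.1 p.2 == s]|%:R.

(* Simulator distributions D on M u {*, bot} are encoded on
   option (option bool): None = *, Some None = bot, Some (Some b) = b.
   Sampling s~ <- D and outputting s if s~ = *, s~ otherwise: *)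
Definition sim_dist (R : realType) (D : option (option bool) -> R)
  (s : bool) (o : option bool) : R :=
  match o with
  | Some b => D (Some (Some b)) + (if b == s then D None else 0)
  | None => D (Some None)
  end.

Definition is_distr (R : realType) (T : finType) (D : T -> R) : Prop :=
  (forall x, 0 <= D x) /\ \sum_(x : T) D x = 1.

Definition stat_dist (R : realType) (p q : option bool -> R) : R :=
  2^-1 * \sum_(o : option bool) `|p o - q o|.

Definition graph_code_nm (R : realType) (n : nat) (e : rel 'I_n) (eps : R)
  : Prop :=
  forall g h : 'I_n -> 'I_n,
    exists D : option (option bool) -> R,
      is_distr D /\
      forall s : bool, stat_dist (tamper_dist R e g h s) (sim_dist D s) <= eps.

(* Main.v *)
(* Let M be the adjacency matrix minus the constant d/n.  For fixed g, h the
   quantity to bound is  Pr[0 is decoded to 1] - Pr[1 is decoded to 1], which is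
   T / (d (n - d))  for  T = sum of d/n - [y ~ z] over all y, z with g y ~ h z.
   T is a sum over edges (w, x) of -<1_{g^-1 w}, M 1_{h^-1 x}>.  Grouping the
   edges at one endpoint, the expander mixing lemma bounds a group by
   lam * sqrt(|g^-1 w| * sum_x |h^-1 x|).
   - Edges whose two fibres differ in size by a factor at least d contribute at
     most lam * n on either side.
   - The remaining edges are sorted by the dyadic sizes 2^i, 2^j of the two
     fibres, so that |i - j| <= log2 d + O(1).  The mixing lemma, applied a
     second time to the two sets of image vertices, bounds the number of edges
     of block (i, j), and gives O(lam^(3/2) sqrt(P_i Q_j) + d^2 P_i Q_j / n^2)
     with P_i, Q_j the numbers of vertices mapped to the layers i and j.
   Summing, T = O(log(d) lam^(3/2) n + d^2), and the hypothesis on n absorbs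
   the last term. *)
Require Import Defs.
From HB Require Import structures.
From mathcomp Require Import all_boot all_order all_algebra.
From mathcomp Require Import reals exp complex zify ring lra.
Import Order.TTheory GRing.Theory Num.Theory.
Local Open Scope ring_scope.

(** * Norm of the adjacency matrix off the constants *)

Section Spectral.
Local Open Scope sesquilinear_scope.

Definition sqnorm {C : numClosedFieldType} {n : nat} (v : 'rV[C]_n) : C :=
  (v *m v ^t*) 0 0.

Lemma sqnormE (C : numClosedFieldType) n (v : 'rV[C]_n) :
  sqnorm v = \sum_i `|v 0 i| ^+ 2.
Proof.
by rewrite /sqnorm mxE; apply: eq_bigr => i _; rewrite !mxE normCK.
Qed.

Lemma sqnorm_unitary (C : numClosedFieldType) n (v : 'rV[C]_n) (P : 'M_n) :
  P \is unitarymx -> sqnorm (v *m P) = sqnorm v.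
Proof.
by move=> Pu; rewrite /sqnorm trmx_mul map_mxM mulmxA mulmxtVK.
Qed.

Lemma char_poly_conj (F : fieldType) n (P A : 'M[F]_n) :
  P \in unitmx -> char_poly (invmx P *m A *m P) = char_poly A.
Proof.
move=> Pu; rewrite /char_poly.
have -> : char_poly_mx (invmx P *m A *m P) =
    map_mx polyC (invmx P) *m char_poly_mx A *m map_mx polyC P.
  rewrite /char_poly_mx mulmxBr mulmxBl -!map_mxM; congr (_ - _).
  by rewrite -mulmxA -scalar_mxC mulmxA -map_mxM mulVmx // map_mx1 mul1mx.
rewrite !det_mulmx mulrAC -det_mulmx -map_mxM mulVmx // map_mx1.
by rewrite det1 mul1r.
Qed.

Lemma char_poly_spectral (C : numClosedFieldType) n (A : 'M[C]_n) :
  A \is normalmx ->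
  char_poly A = \prod_(x <- codom (spectral_diag A 0)) ('X - x%:P).
Proof.
move=> /orthomx_spectralP {1}->; rewrite char_poly_conj ?spectral_unit //.
rewrite char_poly_trig ?diag_mx_is_trig // big_image /=.
by apply: eq_bigr => i _; rewrite mxE eqxx mulr1n.
Qed.

(* The only eigenvalue allowed to exceed lam must be mu, with eigenspace spanned
   by w, to which v is orthogonal. *)
Lemma normalmx_contraction_ortho (C : numClosedFieldType) n (A : 'M[C]_n)
    (mu lam : C) (w v : 'rV[C]_n) :
  A \is normalmx -> 0 <= lam -> lam < `|mu| ->
  (#|[pred i | (lam < `|spectral_diag A 0 i|)%R]| <= 1)%N ->
  w *m A = mu *: w -> w != 0 -> v *m w ^t* = 0 ->
  sqnorm (v *m A) <= lam ^+ 2 * sqnorm v.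
Proof.
move=> /orthomx_spectralP AE lam0 lt_mu D1 wA wN0 vw.
set P := spectralmx A in AE; set D := spectral_diag A in AE D1.
have Pu : P \is unitarymx by apply: spectral_unitarymx.
have Pt : P ^t* \is unitarymx by rewrite trmxC_unitary.
rewrite invmx_unitary // in AE.
set z := v *m P ^t*; set y := w *m P ^t*.
have vz : sqnorm v = sqnorm z by rewrite sqnorm_unitary.
have -> : sqnorm (v *m A) = sqnorm (z *m diag_mx D).
  by rewrite AE !mulmxA sqnorm_unitary.
have yD : y *m diag_mx D = mu *: y.
  rewrite /y scalemxAl -wA [in RHS]AE !mulmxA.
  by rewrite [RHS]mulmxtVK.
have zy : z *m y ^t* = 0.
  by rewrite /y trmx_mul map_mxM trmxCK mulmxA mulmxKtV.
have yN0 : y != 0.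
  apply: contraNneq wN0 => y0; rewrite -(mulmxKtV w Pu) //.
  by rewrite -/y y0 mul0mx.
clearbody y z.
rewrite vz !sqnormE mulr_sumr ler_sum // => i _.
rewrite mul_mx_diag mxE normrM exprMn mulrC.
have [leD|ltD] := real_leP (normr_real (D 0 i)) (ger0_real lam0).
  by rewrite ler_wpM2r ?exprn_ge0 // ler_pXn2r // nnegrE.
(* In eigenbasis coordinates [y] is supported where the eigenvalue is [mu]. As [mu] exceeds [lam]
   and at most one coordinate does, [y] lives on [i] alone, and orthogonality to [y] kills [z] at
   [i]. *)
have yj j : j != i -> y 0 j = 0.
  move=> ji; have /rowP/(_ j) := yD; rewrite mul_mx_diag !mxE mulrC => /eqP.
  rewrite -subr_eq0 -mulrBl mulf_eq0 subr_eq0 => /orP[/eqP Dmu|/eqP//].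
  move/card_le1_eqP: D1 => /(_ i j); rewrite !inE Dmu => /(_ ltD lt_mu) ij.
  by rewrite ij eqxx in ji.
have yi : y 0 i != 0.
  apply: contraNneq yN0 => yi; apply/eqP/rowP => j; rewrite [RHS]mxE.
  by case: (eqVneq j i) => [->|/yj].
have /matrixP/(_ 0 0) := zy; rewrite !mxE (bigD1 i) //= big1 => [|j ji].
  rewrite addr0 !mxE => /eqP; rewrite mulf_eq0 conjC_eq0 (negPf yi) orbF.
  by move=> /eqP ->; rewrite normr0 expr0n /= !mulr0.
by rewrite !mxE (yj j ji) conjC0 mulr0.
Qed.
End Spectral.

(** Lagrange's identity: twice the difference of the two sides is the sum of the squares of
    [x i * y j - x j * y i]. *)
Lemma sum_cauchy_schwarz (R : realFieldType) (I : finType) (P : pred I)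
    (x y : I -> R) :
  (\sum_(i | P i) x i * y i) ^+ 2 <=
  (\sum_(i | P i) x i ^+ 2) * (\sum_(i | P i) y i ^+ 2).
Proof.
rewrite -(@ler_pM2l _ 2) // mulr_natl mulr2n [leRHS]mulr_natl [leRHS]mulr2n.
rewrite [X in _ <= _ + X]mulrC expr2 !big_distrlr /= -!big_split /=.
apply: ler_sum => i _; rewrite -!big_split /=; apply: ler_sum => j _.
by have := sqr_ge0 (x i * y j - x j * y i); nra.
Qed.

Lemma sum_sqrt_cauchy_schwarz (R : rcfType) (I : finType) (P : pred I)
    (x y : I -> R) :
  (forall i, P i -> 0 <= x i) -> (forall i, P i -> 0 <= y i) ->
  \sum_(i | P i) Num.sqrt (x i * y i) <=
  Num.sqrt ((\sum_(i | P i) x i) * (\sum_(i | P i) y i)).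
Proof.
move=> x0 y0; have s0 : 0 <= \sum_(i | P i) Num.sqrt (x i * y i).
  by apply: sumr_ge0 => i _; apply: sqrtr_ge0.
rewrite -(ger0_norm s0) -sqrtr_sqr ler_wsqrtr //.
have -> : \sum_(i | P i) Num.sqrt (x i * y i) =
    \sum_(i | P i) Num.sqrt (x i) * Num.sqrt (y i).
  by apply: eq_bigr => i Pi; rewrite sqrtrM ?x0.
apply: le_trans (sum_cauchy_schwarz _ _ _ _ _) _.
by rewrite le_eqVlt; apply/orP; left; apply/eqP; congr (_ * _);
  apply: eq_bigr => i Pi; rewrite sqr_sqrtr ?x0 ?y0.
Qed.

Section Contraction.
Variables (R : realType) (n : nat) (e : rel 'I_n) (d : nat) (lam : R).
Hypotheses (eG : undirected_simple e) (ed : regular e d).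

Lemma regular_sum (y : 'I_n) : \sum_z (e y z)%:R = d%:R :> R.
Proof.
rewrite -(ed y) -sum1_card natr_sum [RHS]big_mkcond /=.
by apply: eq_bigr => z _; rewrite inE; case: (e y z).
Qed.

Lemma regular_sum_sym (z : 'I_n) : \sum_y (e y z)%:R = d%:R :> R.
Proof.
by rewrite -(regular_sum z); apply: eq_bigr => y _; rewrite eG.1.
Qed.

(** Cauchy-Schwarz with the 0/1 weights [e y z], which equal their squares; all row and column sums
    are [d]. This serves the case [d <= lam], where no eigenvalue needs to be set apart. *)
Lemma adjacency_norm_le_degree (v : 'I_n -> R) :
  \sum_z (\sum_y v y * (e y z)%:R) ^+ 2 <= d%:R ^+ 2 * \sum_y v y ^+ 2.
Proof.
have le_z z : (\sum_y v y * (e y z)%:R) ^+ 2 <=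
    d%:R * \sum_y v y ^+ 2 * (e y z)%:R.
  have := sum_cauchy_schwarz _ _ xpredT (fun y => v y * (e y z)%:R)
    (fun y => (e y z)%:R : R).
  rewrite (eq_bigr (fun y => v y * (e y z)%:R)) => [|y _]; last first.
    by case: (e y z); rewrite ?mulr1 ?mulr0.
  rewrite [X in _ <= X * _](eq_bigr (fun y => v y ^+ 2 * (e y z)%:R));
    last by move=> y _; case: (e y z); rewrite ?mulr1 ?mulr0 ?expr0n.
  rewrite [X in _ <= _ * X](eq_bigr (fun y => (e y z)%:R));
    last by move=> y _; case: (e y z); rewrite ?expr1n ?expr0n.
  by rewrite regular_sum_sym mulrC.
apply: le_trans (ler_sum _ (fun z _ => le_z z)) _.
rewrite -mulr_sumr exchange_big /= expr2 -mulrA ler_wpM2l // mulr_sumr.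
by apply: ler_sum => y _; rewrite -mulr_sumr regular_sum mulrC.
Qed.

Lemma spectral_expander_contraction (v : 'I_n -> R) :
  0 <= lam -> spectral_expander e lam -> \sum_y v y = 0 ->
  \sum_z (\sum_y v y * (e y z)%:R) ^+ 2 <= lam ^+ 2 * \sum_y v y ^+ 2.
Proof.
move=> lam0 [s [szs _ chi sle]] v0.
(* If [lam < d], then [d], with the all-ones eigenvector, is the eigenvalue exceeding [lam], and [v]
   is orthogonal to that eigenvector. *)
have [led|ltd] := leP d%:R lam.
  apply: le_trans (adjacency_norm_le_degree v) _.
  by rewrite ler_wpM2r ?sumr_ge0 ?ler_pXn2r ?nnegrE // => *; apply: sqr_ge0.
have [n0|n0] := posnP n.
  have no_z (z : 'I_n) : False by case: z => k; rewrite n0.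
  by rewrite !big1 ?mulr0 // => z; case: (no_z z).
pose toC : {rmorphism R -> R[i]} := real_complex R.
pose A := map_mx toC (adj_mx R e).
pose x : 'rV[R[i]]_n := \row_j toC (v j).
have normC (a : R) : `|toC a| = toC `|a|.
  by rewrite /toC normc_def /= expr0n addr0 sqrtr_sqr.
have xA : x *m A = \row_z toC (\sum_y v y * (e y z)%:R).
  apply/rowP => z; rewrite !mxE rmorph_sum; apply: eq_bigr => y _.
  by rewrite !mxE rmorphM.
have sqrow (u : 'I_n -> R) :
    sqnorm (\row_j toC (u j)) = toC (\sum_j u j ^+ 2).
  rewrite sqnormE rmorph_sum; apply: eq_bigr => i _.
  by rewrite mxE normC -rmorphXn real_normK // num_real.
suff: sqnorm (x *m A) <= toC lam ^+ 2 * sqnorm x.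
  by rewrite xA !sqrow -rmorphXn -rmorphM /toC lecR.
have An : A \is normalmx.
  apply: symmetric_normalmx.
    apply/is_hermitianmxP; rewrite expr0 scale1r map_mx_id //.
    by apply/matrixP => i j; rewrite !mxE eG.1.
  by apply/mxOverP => i j; rewrite !mxE; apply/complex_realP; eexists.
pose w : 'rV[R[i]]_n := const_mx 1.
apply: (@normalmx_contraction_ortho _ _ A (toC d%:R) (toC lam) w) => //.
- by rewrite /toC ler0c.
- by rewrite normC ger0_norm // /toC ltcR.
(* The list [s] and the spectral diagonal factor the same characteristic polynomial, hence are
   permutations of each other. Only the head of [s] can exceed [lam], so at most one diagonal entry
   does. *)
- have := char_poly_spectral _ _ _ An.
  rewrite -map_char_poly chi rmorph_prod /=.
  under eq_bigr do rewrite map_polyXsubC.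
  rewrite -(big_map toC xpredT (fun c => 'X - c%:P)) => /prod_XsubC_eq/permP.
  move=> /(_ [pred c | toC lam < `|c|]).
  rewrite [in RHS]/codom /image_mem !count_map => cnt.
  rewrite cardE size_filter; move: cnt; rewrite [RHS](eq_count (a2 :=
    mem [pred i | toC lam < `|spectral_diag A 0 i|])) // => <-.
  case: s szs sle {chi} => [<-//|a t] szt sle /=.
  rewrite (eq_in_count (a2 := pred0)) ?count_pred0 ?addn0 ?leq_b1 //.
  move=> c /(nthP 0)[i lti <-] /=; apply/negbTE; rewrite normC.
  by rewrite /toC ltcR -leNgt; apply: (sle i.+1); rewrite -szt.
- apply/rowP => j; rewrite !mxE mulr1 -(regular_sum_sym j) rmorph_sum.
  by apply: eq_bigr => i _; rewrite !mxE mul1r.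
- apply/negP => /eqP/rowP/(_ (Ordinal n0)); rewrite !mxE => /eqP.
  by rewrite oner_eq0.
apply/matrixP => i j; rewrite !mxE.
rewrite (eq_bigr (fun j => toC (v j))) => [|k _]; last first.
  by rewrite !mxE conjC1 mulr1.
by rewrite -rmorph_sum v0 rmorph0.
Qed.
End Contraction.

(** * The gap between the two acceptance probabilities *)

(** Let [v] be the indicator of [A] minus its mean. It sums to zero and its squared norm is at most
    that of the indicator. Up to sign, the double sum pairs the indicator of [B] with the image of
    [v] under the adjacency matrix, so Cauchy-Schwarz and the contraction bound apply. *)
Lemma expander_mixing (R : realType) (n : nat) (e : rel 'I_n) (d : nat)
    (lam : R) (A B : {set 'I_n}) :
  undirected_simple e -> regular e d -> (0 < n)%N -> 0 <= lam ->
  spectral_expander e lam ->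
  `|\sum_(y in A) \sum_(z in B) (d%:R / n%:R - (e y z)%:R)| <=
  lam * Num.sqrt (#|A|%:R * #|B|%:R).
Proof.
move=> eG ed n0 lam0 elam.
have nN0 : n%:R != 0 :> R by rewrite pnatr_eq0 -lt0n.
pose a : R := #|A|%:R; pose v y : R := (y \in A)%:R - a / n%:R.
have sumA : \sum_y (y \in A)%:R = a :> R.
  rewrite /a -sum1_card natr_sum [RHS]big_mkcond.
  by apply: eq_bigr => y _; case: ifP.
have v0 : \sum_y v y = 0.
  by rewrite sumrB sumA sumr_const card_ord -[_ *+ n]mulr_natr mulfVK // subrr.
have v2 : \sum_y v y ^+ 2 <= a.
  have -> : \sum_y v y ^+ 2 = \sum_y v y * (y \in A)%:R - a / n%:R * \sum_y v y.
    by rewrite mulr_sumr -sumrB; apply: eq_bigr => y _; rewrite /v; ring.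
  rewrite v0 mulr0 subr0 -sumA; apply: ler_sum => y _; rewrite /v.
  case: (y \in A); rewrite ?mulr0 ?mulr1 // gerBl.
  by rewrite divr_ge0 ?ler0n.
have -> : \sum_(y in A) \sum_(z in B) (d%:R / n%:R - (e y z)%:R) =
    - \sum_(z in B) 1 * \sum_y v y * (e y z)%:R.
  rewrite exchange_big -sumrN; apply: eq_bigr => z _; rewrite mul1r.
  under [in RHS]eq_bigr => y _ do rewrite mulrBl.
  rewrite [X in _ = - X]sumrB -mulr_sumr.
  rewrite (regular_sum_sym _ _ _ _ eG ed) opprB sumrB.
  congr (_ - _); last first.
    rewrite big_mkcond; apply: eq_bigr => y _.
    by case: (y \in A); rewrite ?mul1r ?mul0r.
  by rewrite sumr_const -[_ *+ #|A|]mulr_natr -/a; ring.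
rewrite normrN -sqrtr_sqr -(ger0_norm lam0) -sqrtr_sqr -sqrtrM ?sqr_ge0 //.
rewrite ler_wsqrtr //.
apply: le_trans (sum_cauchy_schwarz _ _ _ _ _) _.
rewrite expr1n sumr_const -/a mulrA mulrC ler_wpM2r //.
apply: le_trans (_ : _ <= lam ^+ 2 * \sum_y v y ^+ 2) _; last first.
  by rewrite ler_wpM2l ?sqr_ge0.
apply: le_trans (spectral_expander_contraction _ _ _ _ _ eG ed _ lam0 elam v0).
rewrite big_mkcond; apply: ler_sum => z _.
by case: ifP => // _; apply: sqr_ge0.
Qed.

Section Tampering.
Variables (R : realType) (n : nat) (e : rel 'I_n) (d : nat) (lam : R).
Hypotheses (eG : undirected_simple e) (ed : regular e d).
Hypotheses (n0 : (0 < n)%N) (d0 : (0 < d)%N) (lam0 : 0 < lam).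
Hypothesis elam : spectral_expander e lam.
Implicit Types (g h : 'I_n -> 'I_n) (S : rel 'I_n) (W X : {set 'I_n}).

Definition fibre g (w : 'I_n) : nat := #|[set y | g y == w]|.

(** The relation [S] on image vertices is a parameter so that the edge relation [e] can be cut into
    disjoint pieces, over which [gap] is additive. *)
Definition gap g h S : R :=
  \sum_y \sum_(z | S (g y) (h z)) (d%:R / n%:R - (e y z)%:R).

Lemma sum_fibre g (P : pred 'I_n) :
  \sum_(w | P w) (fibre g w)%:R = #|[set y | P (g y)]|%:R :> R.
Proof.
rewrite -natr_sum -sum1_card; congr _%:R.
rewrite [RHS](partition_big g P) => [|y]; last by rewrite inE.
apply: eq_bigr => w Pw; rewrite /fibre -sum1_card; apply: eq_bigl => y.
by rewrite !inE; case: eqP => [->|]; rewrite ?Pw ?andbF.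
Qed.

Lemma sum_fibreT g : \sum_w (fibre g w)%:R = n%:R :> R.
Proof.
rewrite sum_fibre (_ : [set _ | _] = setT); first by rewrite cardsT card_ord.
by apply/setP => y; rewrite !inE.
Qed.

Lemma gap_sym g h S : gap g h S = gap h g (fun x w => S w x).
Proof.
rewrite /gap (exchange_big_dep xpredT) //=; apply: eq_bigr => z _.
by apply: eq_bigr => y _; rewrite eG.1.
Qed.

(** For each [w], the mixing lemma is applied to the fibre over [w] and the set of all [z] whose
    image is [S]-related to [w]. *)
Lemma gap_le_sum_sqrt g h S :
  gap g h S <= lam * \sum_w Num.sqrt ((fibre g w)%:R *
                                      \sum_(x | S w x) (fibre h x)%:R).
Proof.
rewrite /gap (partition_big g xpredT) //= mulr_sumr; apply: ler_sum => w _.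
rewrite sum_fibre.
have := expander_mixing _ _ _ _ _ [set y | g y == w] [set z | S w (h z)]
  eG ed n0 (ltW lam0) elam.
apply: le_trans; apply: le_trans (ler_norm _).
rewrite le_eqVlt; apply/orP; left; apply/eqP.
apply: eq_big => [y|y /eqP ->]; first by rewrite inE.
by apply: eq_bigl => z; rewrite inE.
Qed.

(** Each summand is at most [d / n], since the term [e y z] is only subtracted. *)
Lemma gap_le_sum_prod g h S :
  gap g h S <= d%:R / n%:R *
    \sum_w (fibre g w)%:R * \sum_(x | S w x) (fibre h x)%:R.
Proof.
rewrite /gap (partition_big g xpredT) //= mulr_sumr; apply: ler_sum => w _.
rewrite sum_fibre -natrM.
apply: (@le_trans _ _ (\sum_(y in [set y | g y == w])
                       \sum_(z in [set z | S w (h z)]) d%:R / n%:R)).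
  rewrite [leRHS](eq_bigl (fun y => g y == w)) => [|y]; last by rewrite inE.
  apply: ler_sum => y /eqP ->.
  rewrite [leRHS](eq_bigl (fun z => S w (h z))) => [|z]; last by rewrite inE.
  by apply: ler_sum => z _; rewrite gerBl.
by rewrite !sumr_const -mulrnA mulnC mulr_natr.
Qed.

(** A vertex [w] has [d] neighbours, and each fibre counted for it is at most a [d]-th of its own
    fibre. These fibres together have at most [fibre g w] elements, so the square root is at most
    [fibre g w], and the fibres of [g] sum to [n]. *)
Lemma gap_far g h S :
  (forall w x, S w x -> e w x /\ (d * fibre h x <= fibre g w)%N) ->
  gap g h S <= lam * n%:R.
Proof.
move=> Sfar; apply: le_trans (gap_le_sum_sqrt g h S) _.
rewrite ler_pM2l // -(sum_fibreT g); apply: ler_sum => w _.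
rewrite -[leRHS]ger0_norm // -sqrtr_sqr ler_wsqrtr // expr2 ler_wpM2l //.
rewrite -(@ler_pM2l _ d%:R) ?ltr0n // mulr_sumr.
apply: (@le_trans _ _ (\sum_(x | e w x) (fibre g w)%:R)).
  rewrite big_mkcond [leRHS]big_mkcond; apply: ler_sum => x _.
  case: ifP => [/Sfar[-> le_wx]|_]; first by rewrite -natrM ler_nat.
  by case: ifP.
rewrite -(regular_sum R _ _ _ ed w) mulr_suml big_mkcond; apply: ler_sum.
by move=> x _; case: (e w x); rewrite ?mul1r ?mul0r.
Qed.

(** * Blocks of edges between image vertices with comparable fibres *)

Definition block W X : rel 'I_n := fun w x => [&& e w x, w \in W & x \in X].

Section Block.
Variables (g h : 'I_n -> 'I_n) (W X : {set 'I_n}) (al be : R).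
Hypotheses (al0 : 0 < al) (be0 : 0 < be).
Hypothesis gW : forall w, w \in W -> al <= (fibre g w)%:R <= 2 * al.
Hypothesis hX : forall x, x \in X -> be <= (fibre h x)%:R <= 2 * be.

Let massW : R := \sum_(w in W) (fibre g w)%:R.
Let massX : R := \sum_(x in X) (fibre h x)%:R.
Let edges : R := \sum_(w in W) \sum_(x in X) (e w x)%:R.

Lemma sum_block w :
  \sum_(x | block W X w x) (fibre h x)%:R <=
  (w \in W)%:R * (2 * be * \sum_(x in X) (e w x)%:R) :> R.
Proof.
rewrite mulr_sumr mulr_sumr big_mkcond [leRHS]big_mkcond.
apply: ler_sum => x _; rewrite /block; case: (w \in W); last first.
  by rewrite andbF mul0r; case: ifP.
case: (boolP (x \in X)) => [/hX/andP[_ le2]|_]; last by rewrite !andbF.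
by case: (e w x); rewrite ?mulr0 //= mul1r mulr1.
Qed.

(** Fibres over [X] are replaced by their upper bound [2 * be]; Cauchy-Schwarz over [w] then
    collects the degrees into [edges]. *)
Lemma gap_block_sqrt :
  gap g h (block W X) <= lam * Num.sqrt (massW * (2 * be * edges)).
Proof.
apply: le_trans (gap_le_sum_sqrt g h (block W X)) _; rewrite ler_pM2l //.
apply: (@le_trans _ _ (\sum_(w in W) Num.sqrt ((fibre g w)%:R *
    (2 * be * \sum_(x in X) (e w x)%:R)))).
  rewrite [leRHS]big_mkcond; apply: ler_sum => w _.
  have := sum_block w; case: (w \in W) => le_w.
    by rewrite mul1r in le_w; rewrite ler_wsqrtr // ler_wpM2l.
  rewrite ler0_sqrtr // mulr_ge0_le0 //.
  by rewrite mul0r in le_w.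
apply: le_trans (sum_sqrt_cauchy_schwarz _ _ _ _ _ _ _) _ => // [w _|].
  by rewrite !mulr_ge0 ?sumr_ge0 // ltW.
by rewrite -mulr_sumr.
Qed.

Lemma gap_block_prod :
  gap g h (block W X) <= 4 * (d%:R / n%:R) * (al * be) * edges.
Proof.
apply: le_trans (gap_le_sum_prod g h (block W X)) _.
rewrite mulrC -[leRHS]mulrA [4 * _]mulrC -[leRHS]mulrA [leRHS]mulrC.
rewrite ler_wpM2r ?divr_ge0 //.
rewrite mulrCA !mulrA mulr_sumr [leRHS]big_mkcond; apply: ler_sum => w _.
have := sum_block w; case: (boolP (w \in W)) => [/gW/andP[_ gw]|_] le_w.
  apply: le_trans (ler_wpM2l _ le_w) _ => //.
  rewrite mul1r.
  apply: le_trans (ler_wpM2r _ gw) _.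
    by rewrite !mulr_ge0 ?sumr_ge0 // ltW.
  by rewrite le_eqVlt; apply/orP; left; apply/eqP; ring.
by rewrite mul0r in le_w; rewrite mulr_ge0_le0.
Qed.

Lemma card_massW : al * #|W|%:R <= massW.
Proof.
rewrite mulr_natr -sumr_const; apply: ler_sum => w /gW/andP[] //.
Qed.

Lemma card_massX : be * #|X|%:R <= massX.
Proof.
rewrite mulr_natr -sumr_const; apply: ler_sum => w /hX/andP[] //.
Qed.

Lemma edges_mixing :
  edges <= d%:R / n%:R * (#|W|%:R * #|X|%:R) +
           lam * Num.sqrt (#|W|%:R * #|X|%:R).
Proof.
have := expander_mixing _ _ _ _ _ W X eG ed n0 (ltW lam0) elam.
under eq_bigr => w _ do rewrite sumrB sumr_const.
rewrite sumrB sumr_const -mulrnA -/edges distrC => /(le_trans (ler_norm _)).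
by rewrite lerBlDl mulnC -[_ *+ (_ * _)]mulr_natr natrM.
Qed.

(* Either the spectral error dominates the number of edges between W and X, and
   the union bound over the smaller side applies, or the expected number does,
   and even the trivial bound on every single edge is affordable. *)
Lemma gap_block_le : (#|W| <= #|X|)%N ->
  gap g h (block W X) <= 2 * (lam * Num.sqrt lam) * Num.sqrt (massW * massX) +
                   8 * d%:R ^+ 2 * (massW * massX) / n%:R ^+ 2.
Proof.
move=> leWX; pose s : R := Num.sqrt (#|W|%:R * #|X|%:R).
have W0 : 0 <= massW by apply: sumr_ge0.
have X0 : 0 <= massX by apply: sumr_ge0.
have nR : 0 < n%:R :> R by rewrite ltr0n.
have s0 : 0 <= s by apply: sqrtr_ge0.
have [le_s|/ltW le_p] := leP (d%:R / n%:R * (#|W|%:R * #|X|%:R)) (lam * s).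
- rewrite ler_wpDr //; first by rewrite !mulr_ge0 ?invr_ge0 ?exprn_ge0.
  apply: le_trans gap_block_sqrt _.
  have -> r : 2 * (lam * Num.sqrt lam) * r = lam * (2 * (Num.sqrt lam * r)).
    by ring.
  rewrite ler_pM2l //.
  have <- : Num.sqrt (4 * (lam * (massW * massX))) =
      2 * (Num.sqrt lam * Num.sqrt (massW * massX)).
    rewrite sqrtrM // sqrtrM ?(ltW lam0) //.
    by rewrite (_ : 4 = 2 ^+ 2) ?sqrtr_sqr ?ger0_norm // -natrX.
  rewrite ler_wsqrtr //.
  have e2 : edges <= 2 * lam * s.
    by apply: le_trans edges_mixing _; rewrite -/s; lra.
  (* The assumption that [W] is the smaller side gives [s <= #|X|]. With [e2] this turns
     [2 * be * edges] into at most [4 * lam * massX]. *)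
  have sX : be * s <= massX.
    apply: le_trans card_massX; rewrite ler_pM2l // /s.
    rewrite -[leRHS]ger0_norm // -sqrtr_sqr ler_wsqrtr // expr2.
    by rewrite ler_wpM2r // ler_nat.
  have -> : 4 * (lam * (massW * massX)) = massW * (4 * lam * massX) by ring.
  rewrite ler_wpM2l //.
  have := ler_wpM2l (ltW be0) e2; have := ler_wpM2l (ltW lam0) sX.
  by rewrite /edges; lra.
- rewrite ler_wpDl ?mulr_ge0 ?sqrtr_ge0 ?(ltW lam0) //.
  apply: le_trans gap_block_prod _.
  have q0 : 0 <= d%:R / n%:R :> R by rewrite divr_ge0.
  (* Inserted into [gap_block_prod], this yields the factor [8 * (d / n) ^ 2], while [al * #|W|] and
     [be * #|X|] are bounded by the masses. *)
  have e2 : edges <= 2 * (d%:R / n%:R * (#|W|%:R * #|X|%:R)).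
    by apply: le_trans edges_mixing _; rewrite -/s; lra.
  have le_mass := ler_pM (mulr_ge0 (ltW al0) (ler0n R #|W|))
    (mulr_ge0 (ltW be0) (ler0n R #|X|)) card_massW card_massX.
  have -> : 8 * d%:R ^+ 2 * (massW * massX) / n%:R ^+ 2 =
      8 * (d%:R / n%:R) ^+ 2 * (massW * massX).
    by rewrite expr_div_n; ring.
  have c0 : 0 <= 4 * (d%:R / n%:R) * (al * be).
    by apply: mulr_ge0; apply: mulr_ge0 => //; apply: ltW.
  apply: le_trans (ler_wpM2l c0 e2) _.
  have := ler_wpM2l (mulr_ge0 (ler0n R 8) (sqr_ge0 (d%:R / n%:R))) le_mass.
  by apply: le_trans; rewrite le_eqVlt; apply/orP; left; apply/eqP; ring.
Qed.
End Block.

Lemma eq_gap g h S1 S2 :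
  (forall w x, S1 w x = S2 w x) -> gap g h S1 = gap g h S2.
Proof.
by move=> S12; apply: eq_bigr => y _; apply: eq_bigl => z; apply: S12.
Qed.

(** The bound is symmetric in the two sides, so the comparison of cardinalities is removed by
    exchanging [g] and [h]. *)
Lemma gap_block g h W X (al be : R) : 0 < al -> 0 < be ->
  (forall w, w \in W -> al <= (fibre g w)%:R <= 2 * al) ->
  (forall x, x \in X -> be <= (fibre h x)%:R <= 2 * be) ->
  gap g h (block W X) <=
    2 * (lam * Num.sqrt lam) * Num.sqrt ((\sum_(w in W) (fibre g w)%:R) *
                                        \sum_(x in X) (fibre h x)%:R) +
    8 * d%:R ^+ 2 * ((\sum_(w in W) (fibre g w)%:R) *
                     \sum_(x in X) (fibre h x)%:R) / n%:R ^+ 2.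
Proof.
move=> al0 be0 gW hX; case/orP: (leq_total #|W| #|X|) => [leWX|leXW].
  exact: (gap_block_le g h W X al be).
rewrite gap_sym [(\sum_(w in W) _) * _]mulrC.
rewrite (@eq_gap _ _ _ (block X W)); first exact: (gap_block_le h g X W be al).
by move=> x w; rewrite /block eG.1 [_ && (x \in X)]andbC.
Qed.

Lemma gapE g h S : gap g h S =
  \sum_y \sum_z (S (g y) (h z))%:R * (d%:R / n%:R - (e y z)%:R).
Proof.
apply: eq_bigr => y _; rewrite big_mkcond; apply: eq_bigr => z _.
by case: (S _ _); rewrite ?mul1r ?mul0r.
Qed.

Lemma fibre_gt0 g y : (0 < fibre g (g y))%N.
Proof. by apply/card_gt0P; exists y; rewrite inE. Qed.

Lemma fibre_le g w : (fibre g w <= n)%N.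
Proof. by rewrite -[leqRHS]card_ord max_card. Qed.

(** * Dyadic layers of fibre sizes *)

Definition level g (w : 'I_n) : 'I_n.+1 := inord (trunc_log 2 (fibre g w)).

Lemma levelE g w : level g w = trunc_log 2 (fibre g w) :> nat.
Proof.
rewrite inordK // ltnS; have [->|f0] := posnP (fibre g w).
  by rewrite trunc_log0.
apply: leq_trans (fibre_le g w).
apply: (leq_trans _ (trunc_logP (isT : 1 < 2)%N f0)).
exact/ltnW/ltn_expl.
Qed.

(** Empty fibres also get level 0, because [trunc_log 2 0 = 0]. They are excluded so that the lower
    bound [2 ^ i] holds on layer [i]. *)
Definition layer g (i : 'I_n.+1) : {set 'I_n} :=
  [set w | (0 < fibre g w)%N & level g w == i].

Lemma layer_fibre g i w : w \in layer g i ->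
  let f : R := (fibre g w)%:R in 2 ^+ i <= f <= 2 * 2 ^+ i.
Proof.
rewrite inE => /andP[f0 /eqP <-] /=; rewrite levelE -exprS -!natrX !ler_nat.
by rewrite trunc_logP //= ltnW // trunc_log_ltn.
Qed.

Definition mass g (i : 'I_n.+1) : R := \sum_(w in layer g i) (fibre g w)%:R.

Lemma mass_ge0 g i : 0 <= mass g i.
Proof. exact: sumr_ge0. Qed.

Lemma sum_mass g : \sum_i mass g i = n%:R.
Proof.
rewrite -(sum_fibreT g) [RHS](bigID (fun w => (0 < fibre g w)%N)) /=.
rewrite [X in _ = _ + X]big1 ?addr0 => [|w]; last by case: (fibre g w).
rewrite [RHS](partition_big (level g) xpredT) //; apply: eq_bigr => i _.
by apply: eq_bigl => w; rewrite inE.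
Qed.

(** The fibre over [x] is smaller than 2 to the power [level h x + 1]; the strict inequality between
    the levels pays for this extra 1. *)
Lemma far_fibres g h L w x : (d <= 2 ^ L)%N -> (level h x + L < level g w)%N ->
  (d * fibre h x <= fibre g w)%N.
Proof.
rewrite !levelE => leL lt_L; have f0 : (0 < fibre g w)%N.
  by move: lt_L; case: (fibre g w) => //; rewrite trunc_log0.
apply: (leq_trans _ (trunc_logP (isT : 1 < 2)%N f0)).
apply: (@leq_trans (2 ^ (L + (trunc_log 2 (fibre h x)).+1))).
  by rewrite expnD leq_mul // ltnW // trunc_log_ltn.
by rewrite leq_exp2l // addnC addSn.
Qed.

Definition near (L : nat) (i j : 'I_n.+1) := (i <= j + L)%N && (j <= i + L)%N.

Lemma near_sym L i j : near L i j = near L j i.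
Proof. by rewrite /near andbC. Qed.

Lemma card_near L i : (#|[pred j | near L i j]| <= 2 * L + 1)%N.
Proof.
rewrite cardE -(size_map val) -[leqRHS](size_iota (i - L)).
apply: uniq_leq_size.
  by rewrite map_inj_uniq ?enum_uniq //; apply: val_inj.
move=> k /mapP[j]; rewrite mem_enum inE /near mem_iota => /andP[ij ji] -> /=.
lia.
Qed.

(** The vertices [g y] and [h z] have non-empty fibres, so each lies in exactly one layer and no
    pair [y], [z] is counted in two blocks. *)
Lemma gap_near_split g h L :
  gap g h (fun w x => e w x && near L (level g w) (level h x)) =
  \sum_i \sum_(j | near L i j) gap g h (block (layer g i) (layer h j)).
Proof.
rewrite gapE [RHS]pair_big_dep /=.
under [RHS]eq_bigr => p _ do rewrite gapE.
rewrite [RHS]exchange_big; apply: eq_bigr => y _ /=.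
rewrite [RHS]exchange_big; apply: eq_bigr => z _ /=.
rewrite -mulr_suml; congr (_ * _).
rewrite big_mkcond (bigD1 (level g (g y), level h (h z))) //=.
rewrite big1 => [|[i j] /= ij]; last first.
  case: ifP => // _; rewrite /block !inE !fibre_gt0 /=.
  move: ij; rewrite xpair_eqE [i == _]eq_sym [j == _]eq_sym negb_and.
  by case/orP => /negPf ->; rewrite ?andbF.
rewrite addr0 /block !inE !fibre_gt0 !eqxx !andbT.
by case: ifP; rewrite ?andbT ?andbF.
Qed.

Lemma gap_split g h L : gap g h e =
  gap g h (fun w x => e w x && (level h x + L < level g w)%N) +
  gap g h (fun w x => e w x && (level g w + L < level h x)%N) +
  gap g h (fun w x => e w x && near L (level g w) (level h x)).
Proof.
rewrite !gapE -!big_split; apply: eq_bigr => y _ /=.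
rewrite -!big_split; apply: eq_bigr => z _ /=.
rewrite -!mulrDl; congr (_ * _); rewrite -!natrD /near; congr _%:R.
case: (e _ _) => //=; lia.
Qed.

Lemma gap_edges_le g h L : (d <= 2 ^ L)%N ->
  gap g h e <= 2 * lam * n%:R +
    2 * (lam * Num.sqrt lam) * ((2 * L + 1)%:R * n%:R) + 8 * d%:R ^+ 2.
Proof.
move=> leL; rewrite (gap_split g h L) -addrA.
have far1 : gap g h (fun w x => e w x && (level h x + L < level g w)%N) <=
    lam * n%:R.
  by apply: gap_far => w x /andP[ewx lt_L]; split=> //; apply: far_fibres lt_L.
have far2 : gap g h (fun w x => e w x && (level g w + L < level h x)%N) <=
    lam * n%:R.
  rewrite gap_sym; apply: gap_far => x w /andP[ewx lt_L]; rewrite eG.1.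
  by split=> //; apply: far_fibres lt_L.
have near_le : gap g h (fun w x => e w x && near L (level g w) (level h x)) <=
    2 * (lam * Num.sqrt lam) * ((2 * L + 1)%:R * n%:R) + 8 * d%:R ^+ 2.
  rewrite gap_near_split; set c := 2 * (lam * _).
  have c0 : 0 <= c by rewrite !mulr_ge0 ?sqrtr_ge0 // ltW.
  (* The geometric mean of two masses is replaced by their arithmetic mean, so that the sum becomes
     linear: each mass then occurs in at most [2 * L + 1] near pairs from either side. *)
  apply: (@le_trans _ _ (\sum_i \sum_(j | near L i j)
      (c * ((mass g i + mass h j) / 2) +
       8 * d%:R ^+ 2 / n%:R ^+ 2 * (mass g i * mass h j)))).
    apply: ler_sum => i _; apply: ler_sum => j _.
    apply: le_trans (gap_block g h _ _ (2 ^+ i) (2 ^+ j) _ _ _ _) _;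
      rewrite ?exprn_gt0 //; [exact: layer_fibre|exact: layer_fibre|].
    rewrite -/(mass g i) -/(mass h j) -/c; apply: lerD; last first.
      by rewrite mulrAC.
    rewrite ler_wpM2l //.
    have P0 := mass_ge0 g i; have Q0 := mass_ge0 h j.
    have m0 : 0 <= (mass g i + mass h j) / 2 by rewrite divr_ge0 ?addr_ge0.
    rewrite -[leRHS]ger0_norm // -sqrtr_sqr ler_wsqrtr //.
    by have := sqr_ge0 (mass g i - mass h j); lra.
  under eq_bigr => i _ do rewrite big_split /=.
  rewrite big_split /=; apply: lerD.
    under eq_bigr => i _ do rewrite -mulr_sumr.
    rewrite -mulr_sumr ler_wpM2l //.
    under eq_bigr => i _ do rewrite -mulr_suml.
    rewrite -mulr_suml ler_pdivrMr //.
    under eq_bigr => i _ do rewrite big_split /=.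
    have half g' : \sum_i \sum_(j | near L i j) mass g' i <=
        (2 * L + 1)%:R * n%:R.
      rewrite -(sum_mass g') mulr_sumr; apply: ler_sum => i _.
      rewrite sumr_const -[_ *+ #|_|]mulr_natl ler_wpM2r ?mass_ge0 // ler_nat.
      exact: card_near.
    have half' : \sum_i \sum_(j | near L i j) mass h j <= (2 * L + 1)%:R * n%:R.
      rewrite (exchange_big_dep xpredT) //=; apply: le_trans (half h).
      by apply: ler_sum => j _; under eq_bigl => i do rewrite near_sym.
    by rewrite big_split /=; have := half g; lra.
  (* For the product term the sum is extended to all pairs of layers; the product of the total
     masses is [n ^ 2] and cancels the denominator. *)
  under eq_bigr => i _ do rewrite -mulr_sumr -mulr_sumr.
  rewrite -mulr_sumr -[leRHS](@divfK _ (n%:R ^+ 2));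
    last by rewrite expf_neq0 ?pnatr_eq0 -?lt0n.
  rewrite ler_wpM2l ?divr_ge0 ?exprn_ge0 ?mulr_ge0 ?exprn_ge0 //.
  rewrite expr2 -{1}(sum_mass g) -(sum_mass h) mulr_suml; apply: ler_sum => i _.
  rewrite ler_wpM2l ?mass_ge0 //.
  rewrite big_mkcond; apply: ler_sum => j _.
  by case: ifP => // _; apply: mass_ge0.
by have := lerD far1 (lerD far2 near_le); lra.
Qed.
End Tampering.

(** * From the gap to non-malleability *)

Lemma sum_option (V : nmodType) (T : finType) (F : option T -> V) :
  \sum_o F o = F None + \sum_t F (Some t).
Proof.
rewrite (bigD1 None) //=; congr (_ + _).
rewrite (reindex_omap Some id) => [|[t|]] //=.
by apply: eq_bigl => t; rewrite eqxx.
Qed.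

Section Code.
Variables (R : realType) (n : nat) (e : rel 'I_n).
Implicit Types (g h : 'I_n -> 'I_n) (s : bool).

Definition hit g h s : R := tamper_dist R e g h s (Some true).

Lemma tamper_dist_None g h s : tamper_dist R e g h s None = 0.
Proof.
rewrite /tamper_dist (_ : [set _ | _] = set0) ?cards0 ?mul0r //.
by apply/setP => p; rewrite !inE andbF.
Qed.

Lemma card_hit_split g h s :
  (#|[set p : 'I_n * 'I_n | (e p.1 p.2 == s) &&
      (graph_dec e (g p.1) (h p.2) == Some true)]| +
   #|[set p : 'I_n * 'I_n | (e p.1 p.2 == s) &&
      (graph_dec e (g p.1) (h p.2) == Some false)]|)%N =
  #|[set p : 'I_n * 'I_n | e p.1 p.2 == s]|.
Proof.
rewrite -[RHS](cardsID [set p | e (g p.1) (h p.2)]); congr (_ + _)%N;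
  apply: eq_card => p; rewrite !inE /graph_dec ?[_ && (_ == s)]andbC;
  by congr (_ && _); case: (e (g _) _).
Qed.

Lemma tamper_dist_false g h s :
  (0 < #|[set p : 'I_n * 'I_n | e p.1 p.2 == s]|)%N ->
  tamper_dist R e g h s (Some false) = 1 - hit g h s.
Proof.
move=> E0; apply/eqP; rewrite eq_sym subr_eq /hit /tamper_dist -mulrDl -natrD.
by rewrite addnC card_hit_split divff // pnatr_eq0 -lt0n.
Qed.

Lemma hit_ge0 g h s : 0 <= hit g h s.
Proof. by rewrite divr_ge0. Qed.

Lemma hit_le1 g h s : hit g h s <= 1.
Proof.
(* On an empty support the quotient is 0, as the inverse of 0 is 0. *)
have [E0|E0] := posnP #|[set p : 'I_n * 'I_n | e p.1 p.2 == s]|.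
  by rewrite /hit /tamper_dist E0 invr0 mulr0.
by rewrite /hit /tamper_dist ler_pdivrMr ?ltr0n // mul1r ler_nat
  -(card_hit_split g h) leq_addr.
Qed.

(** Only one sign of the difference matters. If [p0 <= p1], a simulator that keeps the message with
    probability [p1 - p0] and outputs 1 with probability [p0] is exact. Otherwise a
    message-independent simulator outputs 1 with the midpoint probability and errs by
    [(p0 - p1) / 2], whence the factor 2. *)
Lemma graph_code_nm_hit (eps : R) :
  (forall s, 0 < #|[set p : 'I_n * 'I_n | e p.1 p.2 == s]|)%N ->
  0 <= eps -> (forall g h, hit g h false - hit g h true <= 2 * eps) ->
  graph_code_nm e eps.
Proof.
move=> E0 eps0 hit_le g h; have {}hit_le := hit_le g h.
set p0 := hit g h false in hit_le; set p1 := hit g h true in hit_le.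
have p0_ge0 : 0 <= p0 := hit_ge0 g h false.
have p1_ge0 : 0 <= p1 := hit_ge0 g h true.
have p0_le1 : p0 <= 1 := hit_le1 g h false.
have p1_le1 : p1 <= 1 := hit_le1 g h true.
have distE D s : stat_dist (tamper_dist R e g h s) (sim_dist D s) =
    2^-1 * (`|D (Some None)| + (`|hit g h s - sim_dist D s (Some true)| +
            `|1 - hit g h s - sim_dist D s (Some false)|)).
  rewrite /stat_dist sum_option big_bool tamper_dist_None tamper_dist_false //.
  by rewrite sub0r normrN.
pose dist (star t : R) (o : option (option bool)) :=
  match o with
  | None => star | Some None => 0
  | Some (Some b) => if b then t else 1 - star - t
  end.
have dist_distr star t : 0 <= star -> 0 <= t -> star + t <= 1 ->
    is_distr (dist star t).
  move=> s0 t0 st; split; first by move=> [[[]|]|] /=; lra.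
  by rewrite !sum_option big_bool /=; ring.
have [le01|lt10] := leP p0 p1.
  exists (dist (p1 - p0) p0); split; first by apply: dist_distr; lra.
  move=> s; rewrite distE; apply: le_trans eps0.
  rewrite pmulr_rle0 ?invr_gt0 // normr0 add0r.
  have -> : hit g h s - sim_dist (dist (p1 - p0) p0) s (Some true) = 0.
    by case: s => /=; rewrite -/p0 -/p1; ring.
  have -> : 1 - hit g h s - sim_dist (dist (p1 - p0) p0) s (Some false) = 0.
    by case: s => /=; rewrite -/p0 -/p1; ring.
  by rewrite normr0 addr0.
exists (dist 0 ((p0 + p1) / 2)); split; first by apply: dist_distr; lra.
move=> s; rewrite distE normr0 add0r.
have -> : 1 - hit g h s - sim_dist (dist 0 ((p0 + p1) / 2)) s (Some false) =
    - (hit g h s - sim_dist (dist 0 ((p0 + p1) / 2)) s (Some true)).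
  by case: s => /=; ring.
rewrite normrN; case: s => /=; rewrite -/p0 -/p1 addr0.
  by rewrite ler0_norm; lra.
by rewrite ger0_norm; lra.
Qed.
End Code.

Section Hit.
Variables (R : realType) (n : nat) (e : rel 'I_n) (d : nat).
Hypothesis ed : regular e d.

Lemma card_pairs (P : 'I_n -> 'I_n -> bool) :
  #|[set p : 'I_n * 'I_n | P p.1 p.2]|%:R = \sum_y \sum_z (P y z)%:R :> R.
Proof.
rewrite pair_big -sum1_card natr_sum [LHS]big_mkcond; apply: eq_bigr => p _.
by rewrite inE; case: (P _ _).
Qed.

Lemma card_edges : #|[set p : 'I_n * 'I_n | e p.1 p.2 == true]| = (n * d)%N.
Proof.
apply/eqP; rewrite -(eqr_nat R) (card_pairs (fun y z => e y z == true)) natrM.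
under eq_bigr => y _.
  under eq_bigr => z _ do rewrite eqb_id.
  rewrite (regular_sum R _ _ _ ed); over.
by rewrite sumr_const card_ord mulr_natl.
Qed.

Lemma card_non_edges :
  #|[set p : 'I_n * 'I_n | e p.1 p.2 == false]| = (n * (n - d))%N.
Proof.
rewrite cardsCs card_prod card_ord mulnBr -card_edges; congr (_ - _)%N.
by apply: eq_card => p; rewrite !inE; case: (e _ _).
Qed.

(** Let [M s] count the pairs with adjacency value [s] that are sent to edges. Then [gap] is
    [d / n * (M false + M true) - M true], and the two supports have sizes [n * (n - d)] and
    [n * d]. *)
Lemma hit_gap g h : (0 < d < n)%N ->
  hit R n e g h false - hit R n e g h true =
  gap R n e d g h e / (d%:R * (n%:R - d%:R)).
Proof.
move=> /andP[d0 dn]; have n0 := ltn_trans d0 dn.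
pose M s : R := \sum_y \sum_z ((e y z == s) && e (g y) (h z))%:R.
have hitE s : hit R n e g h s =
    M s / #|[set p : 'I_n * 'I_n | e p.1 p.2 == s]|%:R.
  rewrite /hit /tamper_dist.
  rewrite (card_pairs (fun y z => (e y z == s) &&
    (graph_dec e (g y) (h z) == Some true))); congr (_ / _).
  apply: eq_bigr => y _; apply: eq_bigr => z _; rewrite /graph_dec.
  by case: (e (g y) (h z)).
have gapM : gap R n e d g h e = d%:R / n%:R * (M false + M true) - M true.
  rewrite gapE /M -big_split mulr_sumr -sumrB; apply: eq_bigr => y _ /=.
  rewrite -big_split mulr_sumr -sumrB; apply: eq_bigr => z _ /=.
  by case: (e y z); case: (e _ _) => /=; ring.
rewrite !hitE card_edges card_non_edges gapM !natrM natrB ?(ltnW dn) //.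
have nN0 : n%:R != 0 :> R by rewrite pnatr_eq0 -lt0n.
have dN0 : d%:R != 0 :> R by rewrite pnatr_eq0 -lt0n.
have ndN0 : n%:R - d%:R != 0 :> R by rewrite subr_eq0 eqr_nat gtn_eqF.
by field; rewrite ?nN0 ?dN0 ?ndN0.
Qed.
End Hit.

(** * Numerical estimates and the choice of constants *)

(** The mixing lemma on single vertices gives [1 - d / n <= lam] from an edge and [d / n <= lam]
    from a vertex paired with itself. This lower bound lets terms linear in [lam] be absorbed into
    [lam ^ (3/2)]. *)
Lemma expander_ge_half (R : realType) (n : nat) (e : rel 'I_n) (d : nat)
    (lam : R) : undirected_simple e -> regular e d -> (0 < d < n)%N ->
  0 <= lam -> spectral_expander e lam -> 2^-1 <= lam.
Proof.
move=> eG ed /andP[d0 dn] lam0 elam.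
have n0 := ltn_trans d0 dn; pose y := Ordinal n0.
have [z yz] : exists z, e y z.
  by move: d0; rewrite -(ed y) => /card_gt0P[z]; rewrite inE; exists z.
have := expander_mixing R n e d lam [set y] [set y] eG ed n0 lam0 elam.
have := expander_mixing R n e d lam [set y] [set z] eG ed n0 lam0 elam.
rewrite !big_set1 !cards1 yz eG.2 mulr1 sqrtr1 mulr1 subr0.
rewrite distrC => /(le_trans (ler_norm _)) le1 /(le_trans (ler_norm _)).
by move: le1 => /=; lra.
Qed.

(** With [t] the truncated logarithm, [t >= 1] gives [2 * (t + 1) + 1 <= 5 * t]. *)
Lemma ln_up_log2 (R : realType) (d : nat) : (2 <= d)%N ->
  (2 * (trunc_log 2 d).+1 + 1)%:R * ln 2 <= 5 * ln (d%:R : R).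
Proof.
move=> d2; have d0 : (0 < d)%N by apply: ltnW.
set t := trunc_log 2 d.
have t1 : (1 <= t)%N by apply: trunc_log_max.
have le_t : t%:R * ln 2 <= ln (d%:R : R).
  rewrite mulr_natl -lnXn // ler_ln ?posrE ?exprn_gt0 ?ltr0n //.
  by rewrite -natrX ler_nat trunc_logP.
have k0 : 0 < ln (2 : R) by apply: ln_gt0; rewrite ltr1n.
apply: (@le_trans _ _ (5 * (t%:R * ln 2))); last by rewrite ler_pM2l.
by rewrite mulrA ler_pM2r // -natrM ler_nat; lia.
Qed.

Theorem theorem3p3 (R : realType) (c : R) (hc : 0 < c) :
  exists C a : R, 0 < C /\ 0 < a /\
  forall (n : nat) (e : rel 'I_n) (d : nat) (lam : R),
    undirected_simple e -> regular e d ->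
    (2 <= d)%N -> (d < n)%N ->
    0 < lam -> spectral_expander e lam ->
    c * (d%:R ^+ 3) * (ln (d%:R : R)) ^+ 4 / lam <= n%:R ->
    graph_code_nm e (C * (ln (d%:R : R)) `^ a * lam `^ (3 / 2) / d%:R).
Proof.
pose k := ln (2 : R); have k0 : 0 < k by apply: ln_gt0; rewrite ltr1n.
have ck0 : 0 < c * k ^+ 5 by rewrite mulr_gt0 ?exprn_gt0.
(* In units of [q * r * n] with [q = l / k], the three terms of [gap_edges_le] cost 4, 10 and
   [16 / K], where [K = c * k ^ 4]; dividing by [k] passes from [q] to [l]. *)
exists (14 / k + 16 / (c * k ^+ 5)), 1; split; last split => //.
  by rewrite addr_gt0 ?divr_gt0.
move=> n e d lam eG ed d2 dn lam0 elam hn.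
have d0 : (0 < d)%N by apply: ltnW.
have n0 := ltn_trans d0 dn.
have dR : 1 <= d%:R :> R by rewrite ler1n.
have nR : 0 < n%:R :> R by rewrite ltr0n.
set l := ln (d%:R : R) in hn *.
have kl : k <= l by rewrite ler_ln ?posrE ?ltr0n // ler_nat.
have l0 : 0 < l by apply: lt_le_trans kl.
have lam_half : 2^-1 <= lam.
  by apply: (expander_ge_half R n e d) => //; [rewrite d0|apply: ltW].
pose r := lam * Num.sqrt lam.
have -> : lam `^ (3 / 2) = r.
  have -> : 3 / 2 = 1 + 2^-1 :> R by field.
  by rewrite powRD ?(gt_eqF lam0) ?implybT // powRr1 ?powR12_sqrt ?(ltW lam0).
rewrite powRr1 ?(ltW l0) //.
have sqrt_half : 2^-1 <= Num.sqrt lam.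
  rewrite -(@ler_pXn2r _ 2) ?nnegrE ?sqrtr_ge0 ?invr_ge0 //.
  by rewrite sqr_sqrtr ?(ltW lam0) //; lra.
have r_lam : lam <= 2 * r.
  by have := ler_wpM2l (ltW lam0) sqrt_half; rewrite /r; lra.
have r0 : 0 < r by lra.
pose K := c * k ^+ 4; have K0 : 0 < K by rewrite mulr_gt0 ?exprn_gt0.
pose q := l / k; have q1 : 1 <= q by rewrite ler_pdivlMr // mul1r.
set B := 14 / k + 16 / _.
have BE : B * l = (14 + 16 / K) * q.
  by rewrite /B /K /q; field; rewrite ?gt_eqF.
have Bl0 : 0 <= B * l.
  by rewrite BE mulr_ge0 ?addr_ge0 ?divr_ge0 // ltW // lt_le_trans q1.
(* The hypothesis on [n], with [l >= k] and [d >= 1], gives [K * d ^ 2 <= lam * n]; this is what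
   absorbs the term [8 * d ^ 2]. *)
have le_n : K * d%:R ^+ 2 <= 2 * r * n%:R.
  apply: (@le_trans _ _ (lam * n%:R)); last by rewrite ler_pM2r.
  rewrite ler_pdivrMr // [_ * lam]mulrC in hn; apply: le_trans hn.
  rewrite /K -!(mulrA c) ler_pM2l // [leLHS]mulrC.
  rewrite ler_pM ?exprn_ge0 ?(ltW k0) ?ler_weXn2l //.
  by rewrite ler_pXn2r // nnegrE ltW.
apply: graph_code_nm_hit => [s||g h].
- case: s; rewrite ?(card_edges R _ _ _ ed) ?(card_non_edges R _ _ _ ed).
    by rewrite muln_gt0 n0.
  by rewrite muln_gt0 n0 subn_gt0.
- by rewrite divr_ge0 // mulr_ge0 // ltW.
(* For [n < 2 * d] the factor [n - d] may be small compared with [n], but then [le_n] forces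
   [r / d >= K / 4], so the claimed bound exceeds 1 and is trivial. *)
have [n_lt|n_ge] := ltnP n (2 * d).
  apply: (@le_trans _ _ 1).
    have := hit_le1 R n e g h false; have := hit_ge0 R n e g h true; lra.
  have r_d : K / 4 <= r / d%:R.
    have dR0 : 0 < d%:R :> R by rewrite ltr0n.
    rewrite ler_pdivlMr // -(ler_pM2r dR0).
    have n_le : n%:R <= 2 * d%:R :> R by rewrite -natrM ler_nat ltnW.
    by have := ler_wpM2l (ltW r0) n_le; lra.
  have q_r : K / 4 <= q * (r / d%:R).
    by apply: le_trans r_d _; rewrite ler_peMl // divr_ge0 // ltW.
  have -> : 2 * (B * l * r / d%:R) = 28 * (q * (r / d%:R)) +
      32 / K * (q * (r / d%:R)) by rewrite BE; ring.
  have : 32 / K * (K / 4) <= 32 / K * (q * (r / d%:R)).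
    by rewrite ler_pM2l // divr_gt0.
  have -> : 32 / K * (K / 4) = 8 by field; rewrite gt_eqF.
  by lra.
rewrite (hit_gap R n e d ed) ?d0 //.
have gap_le : gap R n e d g h e <= B * l * r * n%:R.
  have leL : (d <= 2 ^ (trunc_log 2 d).+1)%N by rewrite ltnW // trunc_log_ltn.
  apply: le_trans (gap_edges_le R n e d lam eG ed n0 d0 lam0 elam g h _ leL) _.
  have := ln_up_log2 R d d2; rewrite -/k -/l.
  set m := (2 * _ + 1)%:R => le_m.
  have {}le_m : m <= 5 * q by rewrite /q mulrA ler_pdivlMr.
  have x0 : 0 < r * n%:R by rewrite mulr_gt0.
  have le_d : 8 * d%:R ^+ 2 <= 16 / K * q * (r * n%:R).
    apply: (@le_trans _ _ (16 / K * (r * n%:R))).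
      by rewrite mulrAC ler_pdivlMr //; lra.
    by rewrite ler_pM2r // ler_peMr // divr_ge0 // ltW.
  have := ler_wpM2r (ltW x0) le_m; have := ler_wpM2r (ltW x0) q1.
  have := ler_wpM2r (ltW nR) r_lam; rewrite BE -/r; lra.
(* Now [n <= 2 * (n - d)], so dividing the gap by [d * (n - d)] costs only the factor 2 allowed by
   [graph_code_nm_hit]. *)
have ndR : 2 * d%:R <= n%:R :> R by rewrite -natrM ler_nat.
have dR0 : 0 < d%:R :> R by rewrite ltr0n.
rewrite ler_pdivrMr; last by rewrite mulr_gt0 //; lra.
have -> : 2 * (B * l * r / d%:R) * (d%:R * (n%:R - d%:R)) =
    B * l * r * (2 * (n%:R - d%:R)) by field; rewrite gt_eqF.
apply: le_trans gap_le _; rewrite ler_wpM2l //; last lra.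
by rewrite mulr_ge0 // ltW.
Qed.
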